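(* Let $\epsilon>0$ and $n=(4+\epsilon)f$. Let $[n]$ be partitioned into sets $B$ with $|B|\le f$ and $G=[n]\setminus B$, and let $w_i\in[0,1]$ for $i\in[n]$ satisfy \[\sum_{i\in G}(1-w_i)\le\sum_{i\in B}(1-w_i)+\epsilon^2f/8.\] Let $\rho\ge0$ be defined by $\sum_{i\in B}w_i=(1-\rho)f$. Then: (1) for any $\hat G\subseteq G$ with $|\hat G|=n-2f$, $\sum_{i\in\hat G}w_i^2\ge(1-\max\{\rho/2,\epsilon/8\})^2(n-2f)$; (2) $\sum_{(i\neq j)\in B^2}w_iw_j\le(1-\rho)^2f^2$ and $(1-\rho)^2f\le\sum_{i\in B}w_i^2\le(1-\rho)f$.
   Context: The sum $\sum_{(i\neq j)\in B^2}$ ranges over ordered pairs of distinct elements of $B$. *)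

(* Defs.v *)
From mathcomp Require Import all_boot all_order all_algebra.

(* Main.v *)
From mathcomp Require Import all_boot all_order all_algebra.
From mathcomp Require Import ring lra.
Import Order.TTheory GRing.Theory Num.Theory.
Local Open Scope ring_scope.

(* With m := max(rho/2, eps/8), the deficit hypothesis bounds the total
   deficit sum_G (1 - w_i) of any set G of good indices by
   rho f + eps^2 f / 8 <= m (2 + eps) f = m |G| when |G| = n - 2f, so the
   average weight on G is at least 1 - m; the tangent-line bound
   w^2 >= 2 a w - a^2 then gives sum_G w_i^2 >= (1 - m)^2 |G|.  On B the
   same tangent bound with a = 1 - rho, the pointwise bound w^2 <= w and
   sum_{i <> j} w_i w_j <= (sum_B w)^2 give part (2). *)

Section WeightSums.

Context {R : realFieldType} {I : finType}.
Implicit Types (A C : {set I}) (w : I -> R).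

Lemma ler_sum_subset {A C w} :
  A \subset C -> (forall i, i \in C -> 0 <= w i) ->
  \sum_(i in A) w i <= \sum_(i in C) w i.
Proof.
move=> sAC w_ge0; rewrite [leRHS](big_setID A) /= (setIidPr sAC) lerDl.
by apply: sumr_ge0 => i /setDP[iC _]; exact: w_ge0.
Qed.

Lemma sum_sqr_ge_tangent A w (a : R) :
  2 * a * \sum_(i in A) w i - a ^+ 2 * #|A|%:R <= \sum_(i in A) w i ^+ 2.
Proof.
have -> : a ^+ 2 * #|A|%:R = \sum_(i in A) a ^+ 2 by rewrite sumr_const mulr_natr.
rewrite mulr_sumr -sumrB.
apply: ler_sum => i _; have := sqr_ge0 (w i - a); lra.
Qed.

Lemma sum_sqr_ge_mean A w (a : R) :
  0 <= a -> a * #|A|%:R <= \sum_(i in A) w i ->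
  a ^+ 2 * #|A|%:R <= \sum_(i in A) w i ^+ 2.
Proof.
move=> a_ge0 mean_ge; apply: le_trans (sum_sqr_ge_tangent A w a).
have : a * (a * #|A|%:R) <= a * \sum_(i in A) w i by rewrite ler_wpM2l.
lra.
Qed.

Lemma sum_sqr_le_sum A w :
  (forall i, 0 <= w i <= 1) -> \sum_(i in A) w i ^+ 2 <= \sum_(i in A) w i.
Proof. by move=> w01; apply: ler_sum => i _; case/andP: (w01 i) => ? ?; nra. Qed.

Lemma sum_offdiag_le_sqr_sum A w :
  (forall i, 0 <= w i) ->
  \sum_(i in A) \sum_(j in A | j != i) w i * w j <= (\sum_(i in A) w i) ^+ 2.
Proof.
move=> w_ge0; rewrite expr2 mulr_suml; apply: ler_sum => i _.
rewrite -mulr_sumr ler_wpM2l // [leRHS]big_mkcond [leLHS]big_mkcond /=.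
by apply: ler_sum => j _; case: (j \in A); case: (j != i).
Qed.

End WeightSums.

Section DeficitBounds.

Variables (R : realFieldType) (eps rho : R) (n f : nat).
Variables (B : {set 'I_n}) (w : 'I_n -> R).
Hypotheses (eps_gt0 : 0 < eps) (eps_le8 : eps <= 8).
Hypothesis n_def : n%:R = (4 + eps) * f%:R.
Hypothesis card_B : (#|B| <= f)%N.
Hypothesis w01 : forall i, 0 <= w i <= 1.
Hypothesis deficit : \sum_(i in ~: B) (1 - w i)
  <= \sum_(i in B) (1 - w i) + eps ^+ 2 * f%:R / 8.
Hypothesis rho_ge0 : 0 <= rho.
Hypothesis sum_B : \sum_(i in B) w i = (1 - rho) * f%:R.

Let epsf_ge0 : 0 <= eps * f%:R. Proof. exact: mulr_ge0 (ltW eps_gt0) _. Qed.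

Let m := Num.max (rho / 2) (eps / 8).

Lemma card_good_subset {G : {set 'I_n}} :
  #|G| = (n - 2 * f)%N -> #|G|%:R = (2 + eps) * f%:R :> R.
Proof.
move=> ->; have f_ge0 : (0 : R) <= f%:R by [].
have le2f_n : (2 * f <= n)%N.
  by have := epsf_ge0; rewrite -(ler_nat R) natrM n_def; lra.
by rewrite natrB // natrM n_def; ring.
Qed.

Lemma sum_deficit_good_le {G : {set 'I_n}} : G \subset ~: B ->
  \sum_(i in G) (1 - w i) <= rho * f%:R + eps ^+ 2 * f%:R / 8.
Proof.
move=> sGB; have card_B_le : (#|B|%:R : R) <= f%:R by rewrite ler_nat.
have sum_B_deficit : \sum_(i in B) (1 - w i) = #|B|%:R - (1 - rho) * f%:R.
  by rewrite sumrB sumr_const sum_B.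
apply: le_trans (ler_sum_subset sGB _) _ => [i _|]; first by have := w01 i; lra.
by apply: le_trans deficit _; rewrite sum_B_deficit; lra.
Qed.

Lemma sum_good_ge {G : {set 'I_n}} :
  G \subset ~: B -> #|G| = (n - 2 * f)%N ->
  (1 - m) * #|G|%:R <= \sum_(i in G) w i.
Proof.
move=> sGB cardG; have f_ge0 : (0 : R) <= f%:R by [].
have := sum_deficit_good_le sGB; rewrite sumrB sumr_const card_good_subset //.
have rho_le_m : rho / 2 <= m by rewrite le_max lexx.
have eps_le_m : eps / 8 <= m by rewrite le_max lexx orbT.
have : 0 <= (m - rho / 2) * f%:R by apply: mulr_ge0; lra.
have : 0 <= (m - eps / 8) * (eps * f%:R) by apply: mulr_ge0 => //; lra.
lra.
Qed.

Lemma rho_le1 : (0 < f)%N -> rho <= 1.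
Proof.
move=> f_gt0; have : 0 <= (1 - rho) * f%:R.
  by rewrite -sum_B; apply: sumr_ge0 => i _; case/andP: (w01 i).
by rewrite pmulr_lge0 ?ltr0n //; lra.
Qed.

Lemma sum_sqr_good_ge {G : {set 'I_n}} :
  G \subset ~: B -> #|G| = (n - 2 * f)%N ->
  (1 - m) ^+ 2 * (n%:R - 2 * f%:R) <= \sum_(i in G) w i ^+ 2.
Proof.
move=> sGB cardG; have <- : #|G|%:R = n%:R - 2 * f%:R :> R.
  by rewrite card_good_subset // n_def; ring.
have [f0 | f_gt0] := posnP f.
  rewrite card_good_subset // f0 !mulr0.
  by apply: sumr_ge0 => i _; exact: sqr_ge0.
apply: sum_sqr_ge_mean; last exact: sum_good_ge.
have := rho_le1 f_gt0; have := eps_le8.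
by rewrite /m; case: (lerP (rho / 2) (eps / 8)) => _; lra.
Qed.

Lemma sum_sqr_bad_ge : (1 - rho) ^+ 2 * f%:R <= \sum_(i in B) w i ^+ 2.
Proof.
apply: le_trans (sum_sqr_ge_tangent B w (1 - rho)); rewrite sum_B.
have card_B_le : (#|B|%:R : R) <= f%:R by rewrite ler_nat.
have : (1 - rho) ^+ 2 * #|B|%:R <= (1 - rho) ^+ 2 * f%:R.
  by rewrite ler_wpM2l ?sqr_ge0.
lra.
Qed.

End DeficitBounds.

Theorem lemma4 (R : realFieldType) (eps : R) (n f : nat)
    (B : {set 'I_n}) (w : 'I_n -> R) (rho : R) :
  0 < eps -> eps <= 8 ->
  n%:R = (4 + eps) * f%:R ->
  (#|B| <= f)%N ->
  (forall i, 0 <= w i <= 1) ->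
  \sum_(i in ~: B) (1 - w i) <= \sum_(i in B) (1 - w i) + eps ^+ 2 * f%:R / 8 ->
  0 <= rho ->
  \sum_(i in B) w i = (1 - rho) * f%:R ->
  (forall Ghat : {set 'I_n}, Ghat \subset ~: B -> #|Ghat| = (n - 2 * f)%N ->
     (1 - Num.max (rho / 2) (eps / 8)) ^+ 2 * (n%:R - 2 * f%:R)
       <= \sum_(i in Ghat) w i ^+ 2) /\
  (\sum_(i in B) \sum_(j in B | j != i) w i * w j <= (1 - rho) ^+ 2 * f%:R ^+ 2 /\
   (1 - rho) ^+ 2 * f%:R <= \sum_(i in B) w i ^+ 2 <= (1 - rho) * f%:R).
Proof.
move=> eps_gt0 eps_le8 n_def card_B w01 deficit rho_ge0 sum_B.
have w_ge0 i : 0 <= w i by case/andP: (w01 i).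
split; first exact: sum_sqr_good_ge.
split; first by rewrite -exprMn -sum_B; exact: sum_offdiag_le_sqr_sum.
rewrite sum_sqr_bad_ge //= -sum_B; exact: sum_sqr_le_sum.
Qed.
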